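(* Let $G=(S,A,\downarrow,\to)$ be a labeled transition system, $B\subseteq A$, and let $(\mathcal P,\sqsubseteq)$ be a partition-relation pair over $G$. Define $R=\{(p,q)\in P\times Q\mid P,Q\in\mathcal P,\ P\sqsubseteq Q\}$. If $(\mathcal P,\sqsubseteq)$ is stable with respect to $\downarrow$, $\to$ and $B$, then $R$ is a partial bisimulation with respect to $B$ and $R$ is a preorder.
   Context: A labeled transition system is $G=(S,A,\downarrow,\to)$ with a set of states $S$, a set of actions $A$, a termination predicate $\downarrow\subseteq S$ (write $p\downarrow$) and a transition relation $\to\subseteq S\times A\times S$ (write $p\xrightarrow{a}q$). A relation $R\subseteq S\times S$ is a partial bisimulation with respect to $B\subseteq A$ if for all $(p,q)\in R$: (1) if $p\downarrow$ then $q\downarrow$; (2) if $p\xrightarrow{a}p'$ for some $a\in A$, then there is $q'$ with $q\xrightarrow{a}q'$ and $(p',q')\in R$; (3) if $q\xrightarrow{b}q'$ for some $b\in B$, then there is $p'$ with $p\xrightarrow{b}p'$ and $(p',q')\in R$. A partition-relation pair is $(\mathcal P,\sqsubseteq)$ where $\mathcal P$ is a partition of $S$ and $\sqsubseteq\subseteq\mathcal P\times\mathcal P$ is a partial order. For a class $P$ write $P\downarrow$ if all $p\in P$ terminate and $P\not\downarrow$ if none does. For $P,X\subseteq S$: $P\xrightarrow{a}_\exists X$ means some $p\in P$ has $p\xrightarrow{a}x$ with $x\in X$; $P\xrightarrow{a}_\forall X$ means every $p\in P$ has some $x\in X$ with $p\xrightarrow{a}x$. For $P\in\mathcal P$, $\mathrm{lb}(P)=\bigcup\{Q\in\mathcal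 P\mid Q\sqsubseteq P\}$, $\mathrm{bb}(P)=\bigcup\{Q\in\mathcal P\mid P\sqsubseteq Q\}$. $(\mathcal P,\sqsubseteq)$ is stable (w.r.t. $\downarrow,\to,B$) if: (a) every $P\in\mathcal P$ has $P\downarrow$ or $P\not\downarrow$; (b) if $P\sqsubseteq Q$ and $P\downarrow$ then $Q\downarrow$; (c) for all $P,Q,R\in\mathcal P$, $a\in A$: if $P\sqsubseteq Q$ and $P\xrightarrow{a}_\exists R$ then $Q\xrightarrow{a}_\forall\mathrm{bb}(R)$; (d) for all $P,Q,R\in\mathcal P$, $b\in B$: if $P\sqsubseteq Q$ and $Q\xrightarrow{b}_\exists R$ then $P\xrightarrow{b}_\forall\mathrm{lb}(R)$. *)

(* Defs.v *)
From Stdlib Require Import Relation_Definitions.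
From mathcomp Require Import all_boot.
From mathcomp Require Import boolp classical_sets.

Set Implicit Arguments.
Unset Strict Implicit.
Unset Printing Implicit Defensive.

Local Open Scope classical_set_scope.

Record lts := Lts {
  state :> Type;
  action : Type;
  term : set state;
  trans : state -> action -> state -> Prop }.

Record partial_bisimulation (G : lts) (B : set (action G)) (R : relation G)
    : Prop := PartialBisimulation {
  pbisim_term : forall p q : G, R p q -> term p -> term q;
  pbisim_forth : forall (p q : G) (a : action G) (p' : G),
    R p q -> trans p a p' -> exists2 q', trans q a q' & R p' q';
  pbisim_back : forall (p q : G) (b : action G) (q' : G),
    R p q -> B b -> trans q b q' -> exists2 p', trans p b p' & R p' q' }.

(* [le] is a relation on all of [set G], so being a relation on classes is the
   support condition [pr_sub]; reflexivity is only required at members of PP. *)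
Record partition_relation_pair (G : lts) (PP : set (set G))
    (le : relation (set G)) : Prop := PartitionRelationPair {
  pr_partition : partition PP id [set: G];
  pr_sub : forall P Q, le P Q -> PP P /\ PP Q;
  pr_order : Relation_Definitions.order {P : set G | PP P}
    (fun P Q => le (sval P) (sval Q)) }.

Definition class_term (G : lts) (P : set G) : Prop :=
  forall p, P p -> term p.

(* No state of P terminates: stronger than [~ class_term P]. *)
Definition class_nterm (G : lts) (P : set G) : Prop :=
  forall p, P p -> ~ term p.

Definition trans_ex (G : lts) (P : set G) (a : action G) (X : set G) : Prop :=
  exists2 p, P p & exists2 x, X x & trans p a x.

Definition trans_all (G : lts) (P : set G) (a : action G) (X : set G) : Prop :=
  forall p, P p -> exists2 x, X x & trans p a x.

Definition lb (G : lts) (PP : set (set G)) (le : relation (set G))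
    (P : set G) : set G :=
  \bigcup_(Q in [set Q | PP Q /\ le Q P]) Q.

Definition bb (G : lts) (PP : set (set G)) (le : relation (set G))
    (P : set G) : set G :=
  \bigcup_(Q in [set Q | PP Q /\ le P Q]) Q.

Record stable (G : lts) (B : set (action G)) (PP : set (set G))
    (le : relation (set G)) : Prop := Stable {
  stable_class : forall P, PP P -> class_term P \/ class_nterm P;
  stable_term : forall P Q, PP P -> PP Q ->
    le P Q -> class_term P -> class_term Q;
  stable_forth : forall (P Q R : set G) (a : action G),
    PP P -> PP Q -> PP R ->
    le P Q -> trans_ex P a R -> trans_all Q a (bb PP le R);
  stable_back : forall (P Q R : set G) (b : action G),
    PP P -> PP Q -> PP R -> B b ->
    le P Q -> trans_ex Q b R -> trans_all P b (lb PP le R) }.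

Definition induced_rel (G : lts) (PP : set (set G)) (le : relation (set G))
    : relation G :=
  fun p q => exists P Q : set G, [/\ PP P, PP Q, le P Q, P p & Q q].

(* Main.v *)
Require Import Defs.
From Stdlib Require Import Relation_Definitions.
From mathcomp Require Import all_boot.
From mathcomp Require Import boolp classical_sets.

(** Each state lies in exactly one class, so [induced_rel] compares two states through their classes
    and inherits reflexivity and transitivity from [le] ([induced_rel_preorder]). For the transfer
    conditions ([induced_rel_pbisim]), one move of one state is an existential move of its class;
    stability turns it into a universal move of the related class, hence a move of the given
    partner, into [bb] or [lb] of the target's class, which says exactly that the targets are
    related. *)

Section PartitionRelationPair.
Variables (G : lts) (PP : set (set G)) (le : relation (set G)).
Hypothesis PPle : partition_relation_pair PP le.

Lemma class_of (p : G) : exists2 P, PP P & P p.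
Proof.
have [cover _ _] := pr_partition PPle.
have : setT p by [].
by rewrite -cover => -[P PPP Pp]; exists P.
Qed.

Lemma class_unique (P Q : set G) (p : G) : PP P -> PP Q -> P p -> Q p -> P = Q.
Proof.
have [_ triv _] := pr_partition PPle.
by move=> PPP PPQ Pp Qp; apply: triv => //; exists p.
Qed.

Lemma le_class_refl (P : set G) : PP P -> le P P.
Proof. by move=> PPP; have [refl _ _] := pr_order PPle; apply: (refl (exist _ P PPP)). Qed.

Lemma le_class_trans (P Q R : set G) : le P Q -> le Q R -> le P R.
Proof.
(* The order laws live on the subtype of classes, so membership in [PP] is first recovered from the
   support condition. *)
move=> lePQ leQR; have [PPP PPQ] := pr_sub PPle lePQ.
have [_ PPR] := pr_sub PPle leQR; have [_ trans _] := pr_order PPle.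
exact: (trans (exist _ P PPP) (exist _ Q PPQ) (exist _ R PPR)).
Qed.

Lemma induced_rel_preorder : Relation_Definitions.preorder G (induced_rel PP le).
Proof.
split=> [p | p q r [P [Q [PPP PPQ lePQ Pp Qq]]] [Q' [R [PPQ' PPR leQR Q'q Rr]]]].
  have [P PPP Pp] := class_of p.
  by exists P, P; split=> //; apply: le_class_refl.
(* The middle state [q] comes with two classes, one from each pair; disjointness identifies them, so
   the two inequalities chain. *)
move: leQR; rewrite -(class_unique _ _ _ PPQ PPQ' Qq Q'q) => leQR.
by exists P, R; split=> //; apply: le_class_trans leQR.
Qed.

Lemma induced_rel_pbisim (B : set (action G)) :
  stable B PP le -> partial_bisimulation B (induced_rel PP le).
Proof.
move=> st; split=> [p q | p q a p' | p q b q'] [P [Q [PPP PPQ lePQ Pp Qq]]].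
(* Since classes are uniform for termination, the single terminating state [p] forces all of [P] to
   terminate. *)
- move=> term_p; have [termP | ntermP] := stable_class st PPP.
    exact: (stable_term st PPP PPQ lePQ termP).
  by case: (ntermP _ Pp).
- move=> pap'; have [R PPR Rp'] := class_of p'.
  have PaR : trans_ex P a R by exists p => //; exists p'.
  (* Unfolding [bb], the successor of [q] lies in some class [R'] above [R]. *)
  have [q' [R' [PPR' leRR'] R'q'] qaq'] :=
    stable_forth st PPP PPQ PPR lePQ PaR Qq.
  by exists q' => //; exists R, R'.
- move=> Bb qbq'; have [R PPR Rq'] := class_of q'.
  have QbR : trans_ex Q b R by exists q => //; exists q'.
  have [p' [R' [PPR' leR'R] R'p'] pbp'] :=
    stable_back st PPP PPQ PPR Bb lePQ QbR Pp.
  by exists p' => //; exists R', R.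
Qed.

End PartitionRelationPair.

Theorem theorem3 (G : lts) (B : set (action G)) (PP : set (set G))
    (le : relation (set G)) :
  partition_relation_pair PP le ->
  stable B PP le ->
  partial_bisimulation B (induced_rel PP le) /\
  Relation_Definitions.preorder G (induced_rel PP le).
Proof.
move=> PPle st.
by split; [apply: induced_rel_pbisim | apply: induced_rel_preorder].
Qed.
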